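(* Let $\overline{\,\cdot\,}$ be a continuous antilinear involution on $V$. Then there is no locally convex topology $\tau$ on $\mathcal{S}^\bullet_{\mathrm{alg}}(V)$ having both of the following properties: (1) there is at least one $X\in\mathcal{S}^2(V)\setminus\{0\}$ whose (undeformed) exponential $\exp_\vee(X)=\sum_{n=0}^\infty\frac{X^{\vee n}}{n!}$ exists (i.e. the series converges) in the completion of $\mathcal{S}^\bullet_{\mathrm{alg}}(V)$ under $\tau$; (2) all the products $\star_\Lambda$ for all continuous Hermitian bilinear forms $\Lambda$ on $V$, as well as the $^*$-involution and the projection $\langle\cdot\rangle_0$ onto the scalars, are continuous with respect to $\tau$.
   Context: $V$ is a complex Hausdorff locally convex space whose topology is given by its continuous Hilbert seminorms, i.e. the seminorms $\|v\|_\alpha=\sqrt{\langle v|v\rangle_\alpha}$ of continuous positive (semi-definite) Hermitian forms $\langle\cdot|\cdot\rangle_\alpha$ on $V$ are cofinal in the set of all continuous seminorms on $V$. Continuity of forms on $V$ always refers to this given topology. $\mathcal{T}^\bullet_{\mathrm{alg}}(V)=\bigoplus_{k\ge0}\mathcal{T}^k_{\mathrm{alg}}(V)$ is the tensor algebra ($\mathcal{T}^0_{\mathrm{alg}}(V)=\mathbb{C}$), $\langle X\rangle_k$ the degree-$k$ component of $X$. Let $\mathrm{Sym}^\bullet(x_1\otimes\cdots\otimes x_k)=\frac1{k!}\sum_{\sigma\in\mathfrak{S}_k}x_{\sigma(1)}\otimes\cdots\otimes x_{\sigma(k)}$ be the symmetrisation operator, $\mathcal{S}^\bullet_{\mathrm{alg}}(V)$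 its image (the vector space of symmetric tensors), $\mathcal{S}^2(V)$ the symmetric tensors of degree $2$ (as a vector space), and $X\vee Y:=\mathrm{Sym}^\bullet(X\otimes Y)$, $X^{\vee n}$ the $n$-th power with respect to $\vee$. For a bilinear form $\Lambda$ on $V$, let $P_\Lambda$ be the linear endomorphism of $\mathcal{T}^\bullet_{\mathrm{alg}}(V)\otimes\mathcal{T}^\bullet_{\mathrm{alg}}(V)$ (outer tensor product) with $P_\Lambda\big((x_1\otimes\cdots\otimes x_k)\otimes(y_1\otimes\cdots\otimes y_\ell)\big)=k\ell\,\Lambda(x_k,y_1)\,(x_1\otimes\cdots\otimes x_{k-1})\otimes(y_2\otimes\cdots\otimes y_\ell)$ for $k,\ell\ge1$, and zero if $k=0$ or $\ell=0$ (the tensor sign between the two brackets is the outer one). With $\mu_\vee(X\otimes Y):=\mathrm{Sym}^\bullet(X\otimes Y)$ (product in the tensor algebra on the right), $X\star_\Lambda Y:=\sum_{t=0}^\infty\frac1{t!}\mu_\vee\big((P_\Lambda)^t(X\otimes Y)\big)$ for $X,Y\in\mathcal{S}^\bullet_{\mathrm{alg}}(V)$. The $^*$-involution is the antilinear map with $(x_1\otimes\cdots\otimes x_k)^*:=\overline{x_k}\otimes\cdots\otimes\overline{x_1}$ (complex conjugation on scalars). A bilinear form $\Lambda$ is Hermitian if $\Lambda(v,w)=\overline{\Lambda(\overline w,\overline v)}$ for all $v,w\in V$. *)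

(* Defs.v *)
From HB Require Import structures.
From mathcomp Require Import all_boot all_order all_algebra finmap perm.
From mathcomp Require Import ring_quotient sesquilinear.
From mathcomp Require Import monalg complex.
From mathcomp Require Import boolp classical_sets fsbigop reals topology convex tvs.
From mathcomp Require Import sequences.

Set Implicit Arguments.
Unset Strict Implicit.
Unset Printing Implicit Defensive.

Import Order.TTheory GRing.Theory Num.Theory.
Import numFieldTopology.Exports.

Local Open Scope classical_set_scope.
Local Open Scope ring_scope.

(* Linear extension to the free module {malg R[K]} of a function on K. *)
Section FreeModule.
Context (R : nzRingType) (K : choiceType) (W : lmodType R) (f : K -> W).

Definition free_ext (g : {malg R[K]}) : W := \sum_(k <- msupp g) g@_k *: f k.

Lemma free_extEw (d : {fset K}) g : (msupp g `<=` d)%fset ->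
  free_ext g = \sum_(k <- d) g@_k *: f k.
Proof.
move=> le; rewrite /free_ext (big_fset_incl _ le) => //= x xd /mcoeff_outdom ->.
by rewrite scale0r.
Qed.

Lemma free_ext_linear : linear free_ext.
Proof.
move=> a g h.
have le1 : (msupp g `<=` msupp g `|` msupp h)%fset by exact: fsubsetUl.
have le2 : (msupp h `<=` msupp g `|` msupp h)%fset by exact: fsubsetUr.
have le3 : (msupp (a *: g + h)%R `<=` msupp g `|` msupp h)%fset.
  apply: (fsubset_trans (msuppD_le _ _)).
  by apply: fsetSU; exact: msuppZ_le.
rewrite (free_extEw le1) (free_extEw le2) (free_extEw le3).
rewrite scaler_sumr -big_split /=; apply: eq_bigr => k _.
by rewrite mcoeffD mcoeffZ scalerDl scalerA.
Qed.

HB.instance Definition _ :=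
  GRing.isLinear.Build R {malg R[K]} W _ free_ext free_ext_linear.

Lemma free_extU k : free_ext << k >> = f k.
Proof. by rewrite (free_extEw msuppU_le) big_seq_fset1 mcoeffUU scale1r. Qed.

End FreeModule.

(* The R-module with generators K and relations Rel. *)
Section Presentation.
Context (R : nzRingType) (K : choiceType) (Rel : set {malg R[K]}).

Definition rel_span : {pred {malg R[K]}} := fun g =>
  `[< forall N : set {malg R[K]}, N 0 ->
        (forall a x y, N x -> N y -> N (a *: x + y)) -> Rel `<=` N -> N g >].

Lemma rel_spanP g : reflect
  (forall N : set {malg R[K]}, N 0 ->
     (forall a x y, N x -> N y -> N (a *: x + y)) -> Rel `<=` N -> N g)
  (g \in rel_span).
Proof. exact: asboolP. Qed.

Lemma rel_span_submod : submod_closed rel_span.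
Proof.
split=> [|a x y /rel_spanP Sx /rel_spanP Sy]; apply/rel_spanP => N N0 Nlin RN //.
exact: Nlin (Sx _ N0 Nlin RN) (Sy _ N0 Nlin RN).
Qed.

HB.instance Definition _ :=
  GRing.isSubmodClosed.Build R {malg R[K]} rel_span rel_span_submod.

Definition presented : Type := Quotient.quot rel_span.

HB.instance Definition _ := GRing.Zmodule.on presented.

Local Notation pi := (\pi_(Quotient.quot rel_span)%qT : _ -> presented).

Lemma presentedW (P : presented -> Prop) :
  (forall y, P (pi y)) -> forall x, P x.
Proof. by move=> Py x; rewrite -[x]reprK; exact: Py. Qed.

Definition pscale (a : R) (x : presented) : presented := pi (a *: repr x).

Lemma pi_eqP x y : reflect (pi x = pi y) (x - y \in rel_span).
Proof. by rewrite Quotient.idealrBE; exact: eqP. Qed.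

Lemma pi_linear_def a x y : pi (a *: x + y) = pscale a (pi x) + pi y.
Proof.
rewrite /pscale -[RHS]raddfD; apply/pi_eqP.
rewrite opprD addrACA subrr addr0 -scalerBr rpredZ//.
by apply/pi_eqP; rewrite reprK.
Qed.

Lemma piZ a x : pi (a *: x) = pscale a (pi x).
Proof. by rewrite -[a *: x]addr0 pi_linear_def raddf0 addr0. Qed.

Let pscaleA a b v : pscale a (pscale b v) = pscale (a * b) v.
Proof. by elim/presentedW: v => v; rewrite -!piZ scalerA. Qed.

Let pscale1 : left_id 1 pscale.
Proof. by elim/presentedW=> v; rewrite -!piZ scale1r. Qed.

Let pscaleDr : right_distributive pscale +%R.
Proof.
move=> a; elim/presentedW=> v; elim/presentedW=> w.
by rewrite -raddfD -!piZ scalerDr raddfD.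
Qed.

Let pscaleDl v : {morph pscale^~ v : a b / a + b}.
Proof. by move=> a b; elim/presentedW: v => v; rewrite -!piZ scalerDl raddfD. Qed.

HB.instance Definition _ := GRing.Zmodule_isLmodule.Build R presented
  pscaleA pscale1 pscaleDr pscaleDl.

Definition pgen (k : K) : presented := pi << k >>.

Lemma presented_rel a k1 k2 k3 :
  Rel (<< k1 >> - a *: << k2 >> - << k3 >>) ->
  pgen k1 - a *: pgen k2 - pgen k3 = 0.
Proof.
move=> r; have piB g h : pi (g - h) = pi g - pi h by exact: raddfB.
have pZ g : pi (a *: g) = a *: pi g by exact: piZ.
rewrite /pgen -pZ -!piB -[RHS](raddf0 (\pi_(Quotient.quot rel_span)%qT)).
by apply/pi_eqP; rewrite subr0; apply/rel_spanP => N _ _; exact.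
Qed.

(* The linear map with pgen k |-> f k when f is compatible with Rel (pliftP);
   otherwise a junk value that depends on the representatives. *)
Definition plift (W : lmodType R) (f : K -> W) (x : presented) : W :=
  free_ext f (repr x).

Section Lift.
Context (W : lmodType R) (f : K -> W).
Hypothesis f_Rel : forall r, Rel r -> free_ext f r = 0.

Lemma free_ext_span g : g \in rel_span -> free_ext f g = 0.
Proof.
move=> /rel_spanP /(_ [set h | free_ext f h = 0]); apply.
- exact: linear0.
- by move=> a x y /= fx fy; rewrite linearP /= fx fy scaler0 addr0.
- exact: f_Rel.
Qed.

Lemma plift_pi g : plift f (pi g) = free_ext f g.
Proof.
apply/eqP; rewrite /plift -subr_eq0 -linearB /= free_ext_span//.
by apply/pi_eqP; rewrite reprK.
Qed.

Lemma plift_linear : linear (plift f).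
Proof.
move=> a; elim/presentedW=> v; elim/presentedW=> w.
by rewrite -[_ *: _]piZ -raddfD !plift_pi linearP.
Qed.

Lemma pliftP k : plift f (pgen k) = f k.
Proof. by rewrite plift_pi free_extU. Qed.

End Lift.

Lemma pgen_ind (P : presented -> Prop) : P 0 ->
  (forall a x y, P x -> P y -> P (a *: x + y)) ->
  (forall k, P (pgen k)) -> forall x, P x.
Proof.
move=> P0 Plin Pgen; elim/presentedW=> v; rewrite (monalgE v).
elim/big_ind: _ => [|x y Px Py|k _].
- by rewrite raddf0.
- by rewrite raddfD; have := Plin 1 _ _ Px Py; rewrite scale1r.
- have -> : << v@_k *g k >> = v@_k *: << k >>.
    by apply/malgP => j; rewrite mcoeffZ !mcoeffU mulr_natr.
  have -> : pi (v@_k *: << k >>) = v@_k *: pgen k by exact: piZ.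
  by rewrite -[_ *: pgen k]addr0; exact: Plin.
Qed.

Lemma pgen_ext (W : lmodType R) (f g : presented -> W) : linear f -> linear g ->
  (forall k, f (pgen k) = g (pgen k)) -> f =1 g.
Proof.
move=> lf lg fg.
have f0 : f 0 = 0 by have := lf (-1) 0 0; rewrite scaler0 addr0 scaleN1r addNr.
have g0 : g 0 = 0 by have := lg (-1) 0 0; rewrite scaler0 addr0 scaleN1r addNr.
elim/pgen_ind => [|a x y fx fy|//]; first by rewrite f0 g0.
by rewrite lf lg fx fy.
Qed.

End Presentation.

(* M (x) N as generated by the pairs subject to bilinearity. *)
Section TensorProduct.
Context (R : comNzRingType) (M N : lmodType R).

Variant bilinear_rel : set {malg R[(M * N)%type]} :=
| BilinearRelL a x x' y :
    bilinear_rel (<< (a *: x + x', y) >> - a *: << (x, y) >> - << (x', y) >>)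
| BilinearRelR a x y y' :
    bilinear_rel (<< (x, a *: y + y') >> - a *: << (x, y) >> - << (x, y') >>).

Definition tensor_product := presented bilinear_rel.
HB.instance Definition _ := GRing.Lmodule.on tensor_product.

Definition otimes (x : M) (y : N) : tensor_product := pgen bilinear_rel (x, y).

Definition tp_lift (W : lmodType R) (f : M -> N -> W) :
  tensor_product -> W := plift (fun xy => f xy.1 xy.2).

Section Lift.
Context (W : lmodType R) (f : M -> N -> W).
Hypotheses (fl : forall y, linear (f^~ y)) (fr : forall x, linear (f x)).

Let f_rel r : bilinear_rel r -> free_ext (fun xy => f xy.1 xy.2) r = 0.
Proof.
by case=> [a x x' y|a x y y']; rewrite !linearB /= !linearZ /= !free_extU /= (fl, fr);
  rewrite scalerN addrAC addrK subrr.
Qed.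

Lemma tp_lift_linear : linear (tp_lift f).
Proof. exact: plift_linear. Qed.

Lemma tp_liftE x y : tp_lift f (otimes x y) = f x y.
Proof. exact: pliftP. Qed.

End Lift.

Lemma otimes_linearl y : linear (otimes^~ y).
Proof.
move=> a x x'; apply/eqP; rewrite -subr_eq0 opprD addrA; apply/eqP.
exact: (presented_rel (BilinearRelL a x x' y)).
Qed.

Lemma otimes_linearr x : linear (otimes x).
Proof.
move=> a y y'; apply/eqP; rewrite -subr_eq0 opprD addrA; apply/eqP.
exact: (presented_rel (BilinearRelR a x y y')).
Qed.

End TensorProduct.

(* The complex conjugate of W: same group, scalars acting by their conjugate.
   Antilinear maps into W are linear maps into conj_lmod W. *)
Section ConjLmodule.
Context (C : numClosedFieldType) (W : lmodType C).

Definition conj_lmod : Type := W.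
HB.instance Definition _ := GRing.Zmodule.copy conj_lmod W.

Let cscale (a : C) (x : conj_lmod) : conj_lmod := a^* *: (x : W).

Let cscaleA a b v : cscale a (cscale b v) = cscale (a * b) v.
Proof. by rewrite /cscale scalerA rmorphM. Qed.

Let cscale1 : left_id 1 cscale.
Proof. by move=> v; rewrite /cscale rmorph1 scale1r. Qed.

Let cscaleDr : right_distributive cscale +%R.
Proof. by move=> a v w; rewrite /cscale scalerDr. Qed.

Let cscaleDl v : {morph cscale^~ v : a b / a + b}.
Proof. by move=> a b; rewrite /cscale rmorphD scalerDl. Qed.

HB.instance Definition _ := GRing.Zmodule_isLmodule.Build C conj_lmod
  cscaleA cscale1 cscaleDr cscaleDl.

End ConjLmodule.

Record antilinear_involution (C : numClosedFieldType) (V : lmodType C) :=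
  AntilinearInvolution {
    ai_fun :> V -> V;
    ai_antilinear : forall a x y, ai_fun (a *: x + y) = a^* *: ai_fun x + ai_fun y;
    ai_involutive : involutive ai_fun
  }.

(* The tensor algebra: words in V (x_1 (x) ... (x) x_k is the class of
   [:: x_1; ...; x_k]) subject to linearity in each letter. *)
Section TensorAlgebra.
Context (C : numClosedFieldType) (V : lmodType C).

Variant multilinear_rel : set {malg C[seq V]} :=
| MultilinearRel s t a x y :
    multilinear_rel
      (<< s ++ (a *: x + y) :: t >> - a *: << s ++ x :: t >> - << s ++ y :: t >>).

Definition tensor_algebra := presented multilinear_rel.
HB.instance Definition _ := GRing.Lmodule.on tensor_algebra.

Local Notation T := tensor_algebra.

Definition tens (s : seq V) : T := pgen multilinear_rel s.

Definition multilinear (W : lmodType C) (f : seq V -> W) :=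
  forall s t a x y,
    f (s ++ (a *: x + y) :: t) = a *: f (s ++ x :: t) + f (s ++ y :: t).

Definition ta_lift (W : lmodType C) (f : seq V -> W) : T -> W := plift f.

Section Lift.
Context (W : lmodType C) (f : seq V -> W) (fm : multilinear f).

Let f_rel r : multilinear_rel r -> free_ext f r = 0.
Proof.
case=> s t a x y; rewrite !linearB /= !linearZ /= !free_extU /= fm.
by rewrite scalerN addrAC addrK subrr.
Qed.

Lemma ta_lift_linear : linear (ta_lift f).
Proof. exact: plift_linear. Qed.

Lemma ta_liftE s : ta_lift f (tens s) = f s.
Proof. exact: pliftP. Qed.

End Lift.

Lemma ta_ext (W : lmodType C) (f g : T -> W) : linear f -> linear g ->
  (forall s, f (tens s) = g (tens s)) -> f =1 g.
Proof. exact: pgen_ext. Qed.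

Lemma tens_multilinear : multilinear tens.
Proof.
move=> s t a x y; apply/eqP; rewrite -subr_eq0 opprD addrA; apply/eqP.
exact: (presented_rel (MultilinearRel s t a x y)).
Qed.

Section Lift2.
Context (W : lmodType C) (f : seq V -> seq V -> W).

Definition ta_lift2 (X Y : T) : W := ta_lift (fun s => ta_lift (f s) Y) X.

Hypotheses (fl : forall t, multilinear (f^~ t)) (fr : forall s, multilinear (f s)).

Let fY_multilinear Y : multilinear (fun s => ta_lift (f s) Y).
Proof.
move=> s t a x y; apply: (@ta_ext W (ta_lift _)
  (fun Y => a *: ta_lift (f (s ++ x :: t)) Y + ta_lift (f (s ++ y :: t)) Y)).
- exact: ta_lift_linear.
- move=> b u v; rewrite !ta_lift_linear// !scalerDr !scalerA.
  by rewrite (mulrC a) addrACA.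
- by move=> u; rewrite !ta_liftE// fl.
Qed.

Lemma ta_lift2_linearl Y : linear (ta_lift2^~ Y).
Proof. exact: ta_lift_linear. Qed.

Lemma ta_lift2_linearr X : linear (ta_lift2 X).
Proof.
move=> b u v; apply: (@ta_ext W (ta_lift _)
  (fun X => b *: ta_lift2 X u + ta_lift2 X v)).
- exact: ta_lift_linear.
- move=> c X1 X2; rewrite !ta_lift2_linearl !scalerDr !scalerA.
  by rewrite (mulrC b) addrACA.
- by move=> s; rewrite /ta_lift2 !ta_liftE// ta_lift_linear.
Qed.

Lemma ta_lift2E s t : ta_lift2 (tens s) (tens t) = f s t.
Proof. by rewrite /ta_lift2 !ta_liftE. Qed.

End Lift2.

Definition tmul : T -> T -> T := ta_lift2 (fun s t => tens (s ++ t)).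

Lemma tens_cat_multilinearl t : multilinear (fun s => tens (s ++ t)).
Proof. by move=> s s' a x y; rewrite -!catA tens_multilinear. Qed.

Lemma tens_cat_multilinearr s : multilinear (fun t => tens (s ++ t)).
Proof. by move=> s' t a x y; rewrite !catA tens_multilinear. Qed.

Lemma tmulE s t : tmul (tens s) (tens t) = tens (s ++ t).
Proof.
exact: (ta_lift2E tens_cat_multilinearl tens_cat_multilinearr).
Qed.

(* The homogeneous component <X>_k. *)
Definition component (k : nat) : T -> T :=
  ta_lift (fun s => if size s == k then tens s else 0).

Lemma componentE k s :
  component k (tens s) = if size s == k then tens s else 0.
Proof.
rewrite /component ta_liftE// => u t a x y; rewrite !size_cat/=.
by case: ifP => _; [exact: tens_multilinear|rewrite scaler0 addr0].
Qed.

(* <X>_0, read in C through T^0 = C. *)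
Definition scalar_part : T -> C :=
  ta_lift (fun s => if s is [::] then 1 else 0 : C^o).

Lemma scalar_partE s : scalar_part (tens s) = if s is [::] then 1 else 0.
Proof.
rewrite /scalar_part ta_liftE// => u t a x y.
by case: u => [|z u] /=; rewrite scaler0 addr0.
Qed.

Definition tstar (c : antilinear_involution V) : T -> T :=
  @ta_lift (conj_lmod T) (fun s => tens (rev (map c s))).

Section Star.
Context (c : antilinear_involution V).

Let star_multilinear :
  multilinear (fun s => tens (rev (map c s)) : conj_lmod T).
Proof.
move=> s t a x y; rewrite !map_cat /= ai_antilinear !rev_cat !rev_cons.
by rewrite -!cats1 -!catA /= tens_multilinear.
Qed.

Lemma tstarD a X Y : tstar c (a *: X + Y) = a^* *: tstar c X + tstar c Y.
Proof. exact: (ta_lift_linear star_multilinear). Qed.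

Lemma tstarE s : tstar c (tens s) = tens (rev (map c s)).
Proof. exact: (ta_liftE star_multilinear). Qed.

End Star.

Definition sym_word (n : nat) (s : seq V) : T :=
  (n`!%:R)^-1 *: \sum_(sigma : 'S_n) tens [seq s`_(sigma i) | i <- enum 'I_n].

Definition Sym : T -> T := ta_lift (fun s => sym_word (size s) s).

Lemma sym_word_multilinear : multilinear (fun s => sym_word (size s) s).
Proof.
move=> s t a x y; rewrite !size_cat /=; set n := (size s + _)%N.
rewrite /sym_word scalerA mulrC -scalerA -scalerDr; congr (_ *: _).
rewrite scaler_sumr -big_split; apply: eq_bigr => sigma _ /=.
have ltsn : (size s < n)%N by rewrite /n addnS ltnS leq_addr.
pose j0 := (sigma^-1)%g (Ordinal ltsn).
have sj0 : sigma j0 = Ordinal ltsn by rewrite permKV.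
have := enum_uniq 'I_n.
have : j0 \in enum 'I_n by rewrite mem_enum.
case/splitPr => p1 p2; rewrite cat_uniq /= => /and4P[_ /norP[j1 _] j2 _].
have E z (p : seq 'I_n) : j0 \notin p ->
    [seq (s ++ z :: t)`_(sigma i) | i <- p]
  = [seq (s ++ 0 :: t)`_(sigma i) | i <- p].
  move=> jp; apply/eq_in_map => i ip; rewrite !nth_cat.
  case: ltngtP => // e.
    by rewrite -(subnSK e).
  exfalso; move: jp; rewrite (_ : j0 = i) ?ip//.
  by apply: (@perm_inj _ sigma); rewrite sj0; apply/val_inj.
rewrite !map_cat /= !(E _ p1)// !(E _ p2)// sj0 /= !nth_cat ltnn subnn /=.
exact: tens_multilinear.
Qed.

Lemma Sym_linear : linear Sym.
Proof. exact: (ta_lift_linear sym_word_multilinear). Qed.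

HB.instance Definition _ := GRing.isLinear.Build C T T _ Sym Sym_linear.

Lemma SymE s : Sym (tens s) = sym_word (size s) s.
Proof. exact: (ta_liftE sym_word_multilinear). Qed.

Lemma tstar_Sym (c : antilinear_involution V) X :
  tstar c (Sym X) = Sym (tstar c X).
Proof.
have key s : tstar c (Sym (tens s)) = Sym (tstar c (tens s)).
  rewrite tstarE !SymE size_rev size_map /sym_word.
  set n := size s.
  have c0 : c 0 = 0.
    by have := ai_antilinear c (-1) 0 0; rewrite scaler0 addr0 rmorphN1 scaleN1r addNr.
  have t0 : tstar c 0 = 0.
    by have := tstarD c (-1) 0 0; rewrite scaler0 addr0 rmorphN1 scaleN1r addNr.
  have tZ a u : tstar c (a *: u) = a^* *: tstar c u.
    by rewrite -[a *: u]addr0 tstarD t0 addr0.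
  have tD u v : tstar c (u + v) = tstar c u + tstar c v.
    by have := tstarD c 1 u v; rewrite rmorph1 !scale1r.
  rewrite tZ fmorphV rmorph_nat (big_morph _ tD t0); apply: (congr1 ( *:%R _)).
  pose r : 'S_n := perm (@rev_ord_inj n).
  have rr : (r * r)%g = 1%g by apply/permP => i; rewrite permM !permE rev_ordK.
  rewrite (reindex_inj (h := fun sigma => (r * sigma * r)%g)); last first.
    by move=> u v /mulIg /mulgI.
  apply: eq_bigr => sigma _; rewrite tstarE -map_comp; congr tens.
  have rev_enum : rev (enum 'I_n) = [seq rev_ord i | i <- enum 'I_n].
    apply: (inj_map val_inj); rewrite map_rev val_enum_ord -map_comp.
    apply: (@eq_from_nth _ 0%N); first by rewrite size_rev size_map size_iota size_enum_ord.
    rewrite size_rev size_iota => i ltin.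
    rewrite nth_rev size_iota// nth_iota ?ltn_subrL ?(leq_ltn_trans _ ltin)//.
    by rewrite (nth_map (Ordinal ltin)) ?size_enum_ord//= nth_enum_ord.
  rewrite -map_rev rev_enum -map_comp; apply: eq_map => i /=.
  rewrite !permM [r (rev_ord i)]permE rev_ordK permE; set k := sigma i.
  have ltk : (size s - k.+1 < size s)%N.
    by rewrite ltn_subrL /= (leq_ltn_trans _ (ltn_ord k)).
  by rewrite nth_rev size_map ?(nth_map 0)//.
apply: (@ta_ext (conj_lmod T) (fun X => tstar c (Sym X)) (fun X => Sym (tstar c X)))
  => [a u v|a u v|s].
- by rewrite linearP tstarD.
- by rewrite tstarD linearP.
- exact: key.
Qed.

(* P_Lambda on (x_1 (x) ... (x) x_k) (x) (y_1 (x) ... (x) y_l). *)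
Definition contract_word (L : V -> V -> C) (s t : seq V) : tensor_product T T :=
  match s, t with
  | x :: s', y :: t' =>
      ((size s * size t)%:R * L (last x s') y) *:
        otimes (tens (belast x s')) (tens t')
  | _, _ => 0
  end.

Definition contract (L : V -> V -> C) : tensor_product T T -> tensor_product T T :=
  tp_lift (ta_lift2 (contract_word L)).

Section Contract.
Context (L : {biscalar V}).

Lemma contract_word_rcons s x y t :
  contract_word L (rcons s x) (y :: t) =
  (((size s).+1 * (size t).+1)%:R * L x y) *: otimes (tens s) (tens t).
Proof.
case: s => [|z s]; first reflexivity.
rewrite rcons_cons /contract_word last_rcons belast_rcons.
have -> : size (z :: rcons s x) = (size (z :: s)).+1 by rewrite /= size_rcons.
reflexivity.
Qed.

Lemma contract_word_multilinearl t : multilinear (contract_word L ^~ t).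
Proof.
case: t => [|w t] s u a x y.
  by case: s => [|? ?]; rewrite /= scaler0 addr0.
case/lastP: u => [|u e].
  rewrite !cats1 !contract_word_rcons linearPl /= mulrDr scalerDl scalerA.
  by rewrite mulrCA.
rewrite -!rcons_cons -!rcons_cat !contract_word_rcons !size_cat /=.
by rewrite tens_multilinear otimes_linearl scalerDr !scalerA mulrC.
Qed.

Lemma contract_word_multilinearr s : multilinear (contract_word L s).
Proof.
case/lastP: s => [|s z] u t a x y.
  by rewrite /= scaler0 addr0.
case: u => [|w u].
  rewrite !contract_word_rcons linearPr /= mulrDr scalerDl scalerA.
  by rewrite mulrCA.
rewrite !cat_cons !contract_word_rcons !size_cat /=.
by rewrite tens_multilinear otimes_linearr scalerDr !scalerA mulrC.
Qed.

Lemma contractE s t :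
  contract L (otimes (tens s) (tens t)) = contract_word L s t.
Proof.
rewrite /contract tp_liftE.
- exact: ta_lift2E contract_word_multilinearl contract_word_multilinearr _ _.
- exact: ta_lift2_linearl contract_word_multilinearl contract_word_multilinearr.
- exact: ta_lift2_linearr contract_word_multilinearl contract_word_multilinearr.
Qed.

End Contract.
End TensorAlgebra.

Section ContractLinear.
Context (C : numClosedFieldType) (V : lmodType C) (L : {biscalar V}).
Local Notation T := (tensor_algebra V).

Lemma contract_linear : linear (contract L).
Proof.
apply: tp_lift_linear.
- exact: ta_lift2_linearl (contract_word_multilinearl L) (contract_word_multilinearr L).
- exact: ta_lift2_linearr (contract_word_multilinearl L) (contract_word_multilinearr L).
Qed.

HB.instance Definition _ :=
  GRing.isLinear.Build C _ _ _ (contract L) contract_linear.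

(* Hence the sum over all t in star_product below has finite support. *)
Lemma contract_nilpotent (Z : tensor_product T T) :
  exists n, forall t, (n <= t)%N -> iter t (contract L) Z = 0.
Proof.
have iter_lin t a x y : iter t (contract L) (a *: x + y) =
    a *: iter t (contract L) x + iter t (contract L) y.
  by elim: t => [//|t IH]; rewrite !iterS IH contract_linear.
have iter0 t : iter t (contract L) 0 = 0.
  by elim: t => [//|t IH]; rewrite iterS IH linear0.
have lin_case a x y :
    (exists n, forall t, (n <= t)%N -> iter t (contract L) x = 0) ->
    (exists n, forall t, (n <= t)%N -> iter t (contract L) y = 0) ->
    exists n, forall t, (n <= t)%N -> iter t (contract L) (a *: x + y) = 0.
  move=> [n nx] [m my]; exists (maxn n m) => t; rewrite geq_max => /andP[nt mt].
  by rewrite iter_lin nx// my// scaler0 addr0.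
elim/pgen_ind: Z => [|//|[X Y]]; first by exists 0%N.
rewrite -/(otimes X Y).
elim/pgen_ind: X => [|a x y Hx Hy|s].
- have := @otimes_linearl C T T Y (-1) 0 0; rewrite scaler0 addr0 scaleN1r addNr => ->.
  by exists 0%N.
- by rewrite otimes_linearl; exact: lin_case.
rewrite -/(tens s); elim/pgen_ind: Y => [|a x y Hx Hy|t].
- have := @otimes_linearr C T T (tens s) (-1) 0 0.
  by rewrite scaler0 addr0 scaleN1r addNr => ->; exists 0%N.
- by rewrite otimes_linearr; exact: lin_case.
rewrite -!/(tens _); exists (size s).+1 => n.
elim: n s t => [//|n IH] s t; rewrite ltnS => sn.
have iterZ m a x : iter m (contract L) (a *: x) = a *: iter m (contract L) x.
  by rewrite -[a *: x]addr0 iter_lin iter0 addr0.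
rewrite iterSr contractE; case/lastP: s sn => [_|s x]; first exact: iter0.
rewrite size_rcons => sn; case: t => [|y t].
  by case: s {sn} => [|? ?] /=; exact: iter0.
by rewrite contract_word_rcons iterZ IH// scaler0.
Qed.

End ContractLinear.

Section SymmetricTensors.
Context (C : numClosedFieldType) (V : lmodType C).
Local Notation T := (tensor_algebra V).

Definition is_symmetric : {pred T} := fun X => `[< exists Y, X = Sym Y >].

Lemma is_symmetricP X : reflect (exists Y, X = Sym Y) (X \in is_symmetric).
Proof. exact: asboolP. Qed.

Lemma is_symmetric_submod : submod_closed is_symmetric.
Proof.
split=> [|a X Y /is_symmetricP[X' ->] /is_symmetricP[Y' ->]]; apply/is_symmetricP.
  by exists 0; rewrite linear0.
by exists (a *: X' + Y'); rewrite linearP.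
Qed.

HB.instance Definition _ :=
  GRing.isSubmodClosed.Build C T is_symmetric is_symmetric_submod.

Record sym_tensor := SymTensor { sym_val : T; _ : sym_val \in is_symmetric }.

HB.instance Definition _ := [isSub for sym_val].
HB.instance Definition _ := [Choice of sym_tensor by <:].
HB.instance Definition _ := [SubChoice_isSubLmodule of sym_tensor by <:].

Lemma Sym_symmetric X : Sym X \in is_symmetric.
Proof. by apply/is_symmetricP; exists X. Qed.

Lemma tstar_symmetric (c : antilinear_involution V) (X : sym_tensor) :
  tstar c (sym_val X) \in is_symmetric.
Proof.
case: X => X /= /is_symmetricP[Y ->].
by apply/is_symmetricP; exists (tstar c Y); rewrite tstar_Sym.
Qed.

Definition to_sym (X : T) : sym_tensor := SymTensor (Sym_symmetric X).

Definition sym_one : sym_tensor := to_sym (tens [::]).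

Definition vee (X Y : sym_tensor) : sym_tensor :=
  to_sym (tmul (sym_val X) (sym_val Y)).

Definition vee_pow (X : sym_tensor) (n : nat) : sym_tensor :=
  iter n (vee X) sym_one.

Definition mu_vee : tensor_product T T -> sym_tensor :=
  tp_lift (fun X Y => to_sym (tmul X Y)).

Definition star_product (L : V -> V -> C) (X Y : sym_tensor) : sym_tensor :=
  \sum_(t \in [set: nat])
    (t`!%:R)^-1 *: mu_vee (iter t (contract L) (otimes (sym_val X) (sym_val Y))).

Definition sym_star (c : antilinear_involution V) (X : sym_tensor) : sym_tensor :=
  SymTensor (tstar_symmetric c X).

Definition sym_scalar_part (X : sym_tensor) : C := scalar_part (sym_val X).

Definition of_degree (k : nat) (X : sym_tensor) : Prop :=
  component k (sym_val X) = sym_val X.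

Definition exp_partial_sum (X : sym_tensor) : nat -> sym_tensor :=
  series (fun n => (n`!%:R)^-1 *: vee_pow X n).

End SymmetricTensors.

Section Topologies.
Context (K : numFieldType) (E : lmodType K).

Record topology_on := TopologyOn {
  opens : set_system E;
  opensT : opens setT;
  opensI : setI_closed opens;
  opens_bigcup : forall (I : Type) (f : I -> set E),
    (forall i, opens (f i)) -> opens (\bigcup_i f i)
}.

Definition topologized (tau : topology_on) : Type := E.

HB.instance Definition _ tau := GRing.Lmodule.copy (topologized tau) E.
HB.instance Definition _ tau := isOpenTopological.Build (topologized tau)
  (opensT tau) (@opensI tau) (@opens_bigcup tau).

(* The axioms of tvsType, without its choice of a uniform structure. *)
Definition locally_convex_topology (tau : topology_on) : Prop :=
  [/\ continuous (fun z : topologized tau * topologized tau =>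
        z.1 + z.2 : topologized tau),
      continuous (fun z : K^o * topologized tau => z.1 *: z.2 : topologized tau) &
      exists2 B : set_system (topologized tau),
        (forall b, b \in B -> convex_set b) & basis B].

Lemma topologized_openE (tau : topology_on) :
  (open : set_system (topologized tau)) = opens tau.
Proof. by []. Qed.

End Topologies.

Section Completion.
Context (K : numFieldType).

(* The uniform structure of a tvsType is not required to be the one induced by
   translations, hence Cauchy filters are expressed through differences. *)
Definition tvs_complete (W : tvsType K) : Prop :=
  forall F : set_system W, ProperFilter F ->
    (z.1 - z.2 @[z --> (F, F)] --> (0 : W)) -> exists w : W, F --> w.

(* The completion is the complete Hausdorff locally convex space in which E
   (modulo the closure of 0) embeds densely; it is unique up to isomorphism. *)
Definition is_completion (E : preTopologicalLmodType K) (W : tvsType K)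
    (i : {linear E -> W}) : Prop :=
  [/\ tvs_complete W, hausdorff_space W, dense (range i) &
      forall (x : E) (U : set E),
        nbhs x U <-> exists2 O : set W, nbhs (i x) O & i @^-1` O `<=` U].

Definition cvg_in_completion (E : preTopologicalLmodType K) (u : nat -> E) : Prop :=
  exists (W : tvsType K) (i : {linear E -> W}),
    is_completion i /\ exists w : W, i \o u @ \oo --> w.

End Completion.

Section Forms.
Context (R : realType) (V : tvsType R[i]).

Definition seminorm (p : V -> R) : Prop :=
  (forall x y, p (x + y) <= p x + p y) /\
  (forall a x, p (a *: x) = ComplexField.Normc.normc a * p x).

Definition continuous_form (f : V -> V -> R[i]) : Prop :=
  continuous (fun z : V * V => f z.1 z.2 : R[i]^o).

(* The library's Hermitian forms are linear in the first argument; the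
   seminorms do not depend on that convention. Re loses nothing: h v v is a
   nonnegative real. *)
Definition hilbert_seminorms_cofinal : Prop :=
  forall p : V -> R, seminorm p -> continuous p ->
    exists h : {hermitian_sym V for @Num.conj R[i]},
      [/\ forall v, 0 <= h v v, continuous_form h &
          forall v, p v <= Num.sqrt (complex.Re (h v v))].

Definition hermitian_wrt (c : V -> V) (L : V -> V -> R[i]) : Prop :=
  forall v w, L v w = (L (c w) (c v))^*.

End Forms.

(* Main.v *)
From HB Require Import structures.
From mathcomp Require Import all_boot all_order all_algebra perm.
From mathcomp Require Import sesquilinear complex.
From mathcomp Require Import boolp classical_sets fsbigop reals topology convex tvs.
From mathcomp Require Import interval_inference normedtype sequences ring lra.
Require Import Defs.

Set Implicit Arguments.
Unset Strict Implicit.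
Unset Printing Implicit Defensive.

Import Order.TTheory GRing.Theory Num.Theory.
Import numFieldTopology.Exports.

Local Open Scope classical_set_scope.
Local Open Scope ring_scope.

(** Rank-one Hermitian forms already obstruct such a topology. A continuous linear
    functional phi extends to an algebra homomorphism [tensor_eval phi] from
    tensors to scalars, sending a word to the product of the values of phi on
    its letters; it does not see symmetrisation, so it is multiplicative for
    the symmetric product. Put psi v := conj (phi (conj v)) and
    L v w := psi v * phi w. This bilinear form is continuous and Hermitian
    ([rank_one_form_continuous], [rank_one_form_hermitian]), and for symmetric
    tensors Y, Z of the same degree k the only contraction that reaches the
    scalars is the k-fold one ([scalar_part_star]):
      <Y * Z>_0 = k! * tensor_eval psi Y * tensor_eval phi Z.
    Since psi evaluates Y^* to the conjugate of the value of phi on Y, the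
    terms T_n = X^n / n! of the exponential of X, of degree 2 n, satisfy
    ([scalar_part_star_power])
      <T_n^* * T_n>_0 = (2 n)! / (n!)^2 * |tensor_eval phi X|^(2 n).

    If the exponential converges, T_n tends to 0 ([series_terms_cvg0]), and
    by continuity of the involution, of the product at the origin and of the
    projection, so does the left-hand side. Once phi is rescaled so that it
    evaluates X to 1, the right-hand side is the central binomial coefficient,
    which is at least 1: a contradiction.

    There remains to find a continuous phi that does not kill the nonzero
    symmetric tensor X of degree 2 ([sym2_eval_neq0]). By polarisation, if every
    phi killed X, then phi (x) psi would kill X for all continuous phi and psi;
    as continuous functionals separate the points of V, an elimination
    on the number of pure tensors in X forces X = 0 ([bilinear_sum_eq0]).
    Points are separated as follows: the gauge of a convex balanced neighbourhood
    of 0 that misses v is a continuous seminorm, it is dominated by the seminorm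
    of a continuous positive Hermitian form h, and h (-, v) is then a continuous
    functional that does not vanish at v ([separating_functional]). *)

(** * Linearity and degree in the tensor algebra *)

Section TensorLinear.
Context (C : numClosedFieldType) (V : lmodType C).
Local Notation T := (tensor_algebra V).

Lemma component_linear k : linear (component k : T -> T).
Proof.
apply: ta_lift_linear => s t a x y; rewrite !size_cat /=.
by case: ifP => _; [exact: tens_multilinear|rewrite scaler0 addr0].
Qed.
HB.instance Definition _ k :=
  GRing.isLinear.Build C T T _ (component k) (component_linear k).

Lemma tmul_linearl (Y : T) : linear (fun X : T => tmul X Y).
Proof.
exact: ta_lift2_linearl (@tens_cat_multilinearl C V) (@tens_cat_multilinearr C V) Y.
Qed.

Lemma tmul_linearr (X : T) : linear (fun Y : T => tmul X Y).
Proof.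
exact: ta_lift2_linearr (@tens_cat_multilinearl C V) (@tens_cat_multilinearr C V) X.
Qed.

Lemma ta_ext2 (W : lmodType C) (f g : T -> T -> W) :
  (forall Y, linear (f ^~ Y)) -> (forall X, linear (f X)) ->
  (forall Y, linear (g ^~ Y)) -> (forall X, linear (g X)) ->
  (forall s t, f (tens s) (tens t) = g (tens s) (tens t)) -> f =2 g.
Proof.
move=> fl fr gl gr fg X Y; apply: (ta_ext (fl Y) (gl Y)) => s.
exact: (ta_ext (fr (tens s)) (gr (tens s))).
Qed.

Lemma sym_val_linear : linear (@sym_val C V).
Proof. by []. Qed.
HB.instance Definition _ :=
  GRing.isLinear.Build C (sym_tensor V) T _ (@sym_val C V) sym_val_linear.

Lemma to_sym_linear : linear (@to_sym C V).
Proof. by move=> a X Y; apply: val_inj; rewrite /= linearP. Qed.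
HB.instance Definition _ :=
  GRing.isLinear.Build C T (sym_tensor V) _ (@to_sym C V) to_sym_linear.

Let vee_linearl (Y : T) : linear (fun X => to_sym (tmul X Y)).
Proof. by move=> a X X'; rewrite tmul_linearl linearP. Qed.

Let vee_linearr (X : T) : linear (fun Y => to_sym (tmul X Y)).
Proof. by move=> a Y Y'; rewrite tmul_linearr linearP. Qed.

Lemma mu_veeE (X Y : T) : mu_vee (otimes X Y) = to_sym (tmul X Y).
Proof. exact: (tp_liftE vee_linearl vee_linearr X Y). Qed.

Lemma mu_vee_linear : linear (@mu_vee C V).
Proof. exact: (tp_lift_linear vee_linearl vee_linearr). Qed.
HB.instance Definition _ :=
  GRing.isLinear.Build C (tensor_product T T) (sym_tensor V) _ (@mu_vee C V)
    mu_vee_linear.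

Lemma sym_words_size (n : nat) (s : seq V) (sigma : 'S_n) :
  size [seq s`_(sigma i) | i <- enum 'I_n] = n.
Proof. by rewrite size_map size_enum_ord. Qed.

Lemma component_Sym k (X : T) : component k (Sym X) = Sym (component k X).
Proof.
apply: (@ta_ext C V T (fun X => component k (Sym X)) (fun X => Sym (component k X))).
- by move=> a Y Z; rewrite Sym_linear component_linear.
- by move=> a Y Z; rewrite component_linear Sym_linear.
move=> s; rewrite componentE SymE /sym_word linearZ linear_sum /=.
under eq_bigr do rewrite componentE sym_words_size.
case: eqP => _; first by rewrite SymE.
by rewrite big1 // scaler0 linear0.
Qed.

Lemma component_tmul k l (X Y : T) :
  component (k + l) (tmul (component k X) (component l Y)) =
  tmul (component k X) (component l Y).
Proof.
apply: (@ta_ext2 T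
  (fun X Y => component (k + l) (tmul (component k X) (component l Y)))
  (fun X Y => tmul (component k X) (component l Y))) => {X Y}.
- by move=> Y a X X'; rewrite component_linear tmul_linearl component_linear.
- by move=> X a Y Y'; rewrite component_linear tmul_linearr component_linear.
- by move=> Y a X X'; rewrite component_linear tmul_linearl.
- by move=> X a Y Y'; rewrite component_linear tmul_linearr.
have t0l (Y : T) : tmul 0 Y = 0.
  by have := tmul_linearl Y (-1) 0 0; rewrite scaler0 addr0 scaleN1r addNr.
have t0r (X : T) : tmul X 0 = 0.
  by have := tmul_linearr X (-1) 0 0; rewrite scaler0 addr0 scaleN1r addNr.
move=> s t; rewrite !componentE.
case: eqP => [sk|_]; last by rewrite t0l linear0.
case: eqP => [tl|_]; last by rewrite t0r linear0.
by rewrite tmulE componentE size_cat sk tl eqxx.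
Qed.

Lemma component_component t k (X : T) :
  component t (component k X) = if t == k then component k X else 0.
Proof.
case: eqVneq => [->|tk].
- apply: (@ta_ext C V T (fun X => component k (component k X)) (component k)).
  + by move=> a Y Z; rewrite !component_linear.
  + exact: component_linear.
  move=> s; rewrite componentE; case: ifP => sk; first by rewrite componentE sk.
  exact: linear0.
- apply: (@ta_ext C V T (fun X => component t (component k X)) (fun=> 0)).
  + by move=> a Y Z; rewrite !component_linear.
  + by move=> a Y Z; rewrite scaler0 addr0.
  move=> s; rewrite componentE; case: eqP => [sk|_]; last exact: linear0.
  by rewrite componentE sk eq_sym (negbTE tk).
Qed.

End TensorLinear.

(** * Evaluation of tensors at a functional *)

Section Evaluation.
Context (C : numClosedFieldType) (V : lmodType C).
Local Notation T := (tensor_algebra V).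

(** For linear phi, the algebra homomorphism to C that extends phi, by the universal
    property of the tensor algebra. *)
Definition tensor_eval (phi : V -> C) : T -> C^o :=
  ta_lift (fun s => \prod_(x <- s) phi x : C^o).

Section Eval.
Context (phi : {linear V -> C^o}).

Lemma word_prod_multilinear :
  multilinear (fun s : seq V => \prod_(x <- s) phi x : C^o).
Proof.
move=> s t a x y; rewrite !big_cat !big_cons /= linearP /=.
by rewrite /GRing.scale /= mulrDl mulrDr -mulrA mulrCA.
Qed.

Lemma tensor_eval_linear : linear (tensor_eval phi).
Proof. exact: ta_lift_linear word_prod_multilinear. Qed.
HB.instance Definition _ :=
  GRing.isLinear.Build C T C^o _ (tensor_eval phi) tensor_eval_linear.

Lemma tensor_evalE s : tensor_eval phi (tens s) = \prod_(x <- s) phi x.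
Proof. exact: ta_liftE word_prod_multilinear s. Qed.

Lemma tensor_evalM X Y :
  tensor_eval phi (tmul X Y) = tensor_eval phi X * tensor_eval phi Y.
Proof.
apply: (@ta_ext2 C V C^o (fun X Y => tensor_eval phi (tmul X Y))
   (fun X Y => tensor_eval phi X * tensor_eval phi Y)) => {X Y}.
- by move=> Y a X X'; rewrite tmul_linearl linearP.
- by move=> X a Y Y'; rewrite tmul_linearr linearP.
- by move=> Y a X X'; rewrite linearP mulrDl -scalerAl.
- by move=> X a Y Y'; rewrite linearP mulrDr -scalerAr.
by move=> s t; rewrite tmulE !tensor_evalE big_cat.
Qed.

(** Each of the n! reordered words has the same product, because scalars
    commute. *)
Lemma tensor_eval_Sym X : tensor_eval phi (Sym X) = tensor_eval phi X.
Proof.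
apply: (@ta_ext C V C^o (fun X => tensor_eval phi (Sym X)) (tensor_eval phi)).
- by move=> a Y Z; rewrite Sym_linear tensor_eval_linear.
- exact: tensor_eval_linear.
move=> s; rewrite SymE /sym_word linearZ linear_sum /= tensor_evalE.
have -> : \prod_(x <- s) phi x = \prod_(i < size s) phi s`_i.
  by rewrite (big_nth 0) big_mkord.
under eq_bigr => sigma _.
  rewrite tensor_evalE big_map big_enum /=.
  rewrite -(reindex_inj (P := xpredT) (F := fun i : 'I__ => phi s`_i) (@perm_inj _ sigma)).
  over.
have n0 : (size s)`!%:R != 0 :> C by rewrite pnatr_eq0 -lt0n fact_gt0.
by rewrite sumr_const card_Sn -scaler_nat scalerA mulVf // scale1r.
Qed.

End Eval.

(** The zero functional kills every nonempty word, so that the projection onto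
    scalars inherits multiplicativity and symmetry from [tensor_eval]. *)
Lemma scalar_part_eval (X : T) : scalar_part X = tensor_eval \0 X.
Proof.
apply: (@ta_ext C V C^o (@scalar_part C V) (tensor_eval \0)).
- apply: ta_lift_linear => u t a x y.
  by case: u => [|z u] /=; rewrite scaler0 addr0.
- exact: tensor_eval_linear.
move=> s; rewrite scalar_partE tensor_evalE.
by case: s => [|x s]; rewrite ?big_nil // big_cons mul0r.
Qed.

End Evaluation.

(** * Star products for rank-one forms *)

Section RankOne.
Context (C : numClosedFieldType) (V : lmodType C).
Local Notation T := (tensor_algebra V).
Context (psi phi : {linear V -> C^o}) (L : {biscalar V}).
Hypothesis LE : forall x y, L x y = psi x * phi y.

Lemma iter_contract_linear t : linear (iter t (contract L)).
Proof. by elim: t => [//|t IH] a x y; rewrite !iterS IH linearP. Qed.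

Lemma sym_scalar_part_linear : linear (@sym_scalar_part C V : _ -> C^o).
Proof. by move=> a X Y; rewrite /sym_scalar_part !scalar_part_eval !linearP. Qed.
HB.instance Definition _ := GRing.isLinear.Build C (sym_tensor V) C^o _
  (@sym_scalar_part C V) sym_scalar_part_linear.

Let value t Z : C^o := sym_scalar_part (mu_vee (iter t (contract L) Z)).

Let value_linear t : linear (value t).
Proof.
by move=> a Y Z; rewrite /value iter_contract_linear mu_vee_linear sym_scalar_part_linear.
Qed.

Let value0 t : value t 0 = 0.
Proof. by have := value_linear t (-1) 0 0; rewrite scaler0 addr0 scaleN1r addNr. Qed.

Let valueZ t a Z : value t (a *: Z) = a *: value t Z.
Proof. by rewrite -[a *: Z]addr0 value_linear value0 addr0. Qed.

(** After t contractions the result has a scalar part only if both words are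
    exhausted, that is, if both had length t. For a form of rank one the factors
    L x y then split into the product of all psi x and that of all phi y. The
    lengths t, t - 1, ..., 1 of the successive words enter as coefficients from
    either side, whence (t!)^2. *)
Lemma scalar_part_contract t (X Y : T) :
  sym_scalar_part (mu_vee (iter t (contract L) (otimes X Y))) =
  (t`!%:R) ^+ 2 * tensor_eval psi (component t X) * tensor_eval phi (component t Y).
Proof.
rewrite -/(value t (otimes X Y)).
apply: (@ta_ext2 C V C^o (fun X Y => value t (otimes X Y)) (fun X Y =>
  (t`!%:R) ^+ 2 * tensor_eval psi (component t X) * tensor_eval phi (component t Y)))
  => {X Y}.
- by move=> Y a X X'; rewrite otimes_linearl value_linear.
- by move=> X a Y Y'; rewrite otimes_linearr value_linear.
- move=> Y a X X'; rewrite component_linear tensor_eval_linear.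
  by rewrite mulrDr mulrDl -scalerAr -scalerAl.
- move=> X a Y Y'; rewrite component_linear tensor_eval_linear.
  by rewrite mulrDr -scalerAr.
elim: t => [|t IH] s u.
  rewrite /value /= mu_veeE /sym_scalar_part scalar_part_eval /= tensor_eval_Sym tmulE.
  rewrite tensor_evalE big_cat fact0 expr1n mul1r !componentE /=.
  case: s => [|x s] /=; last by rewrite big_cons !mul0r linear0 mul0r.
  rewrite tensor_evalE !big_nil !mul1r.
  by case: u => [|y u] /=; [rewrite tensor_evalE !big_nil|rewrite big_cons mul0r linear0].
rewrite /value iterSr -/(value t _) contractE !componentE.
case/lastP: s => [|s x]; first by rewrite value0 linear0 mulr0 mul0r.
case: u => [|y u].
  rewrite [tensor_eval phi _]linear0 mulr0.
  by case: s => [|z s] /=; rewrite value0.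
rewrite contract_word_rcons valueZ IH LE !componentE size_rcons.
rewrite [size (y :: u)]/= !eqSS.
case: eqP => [->|_]; last by rewrite !linear0 !mulr0 !mul0r scaler0.
case: eqP => [->|_]; last by rewrite !linear0 !mulr0 scaler0.
rewrite !tensor_evalE big_cons big_rcons /= factS !natrM.
rewrite /GRing.scale /=.
set P := \prod_(j <- s) _; set Q := \prod_(j <- u) _.
(* The goal lives in the regular module C^o, where scaling is multiplication; the
   identity is proved in the field C, to which it is convertible. *)
have key (a b p q p' q' : C) :
    a * a * (p * q) * (b ^+ 2 * p' * q') = (a * b) ^+ 2 * (p' * p) * (q * q').
  by ring.
exact: key.
Qed.

(** Of the series defining the star product only the term t = k survives, and its
    factor 1/k! leaves one of the two factorials of [scalar_part_contract]. *)
Lemma scalar_part_star k (X Y : sym_tensor V) : of_degree k X -> of_degree k Y ->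
  sym_scalar_part (star_product L X Y) =
  k`!%:R * tensor_eval psi (sym_val X) * tensor_eval phi (sym_val Y).
Proof.
move=> Xk Yk; have [n nP] := contract_nilpotent L (otimes (sym_val X) (sym_val Y)).
(* The range is enlarged beyond n so that the index k lies in it. *)
pose m := maxn n k.+1.
have km : (k < m)%N by rewrite leq_max ltnSn orbT.
rewrite /star_product -(@fsbig_widen _ _ _ _ `I_m) //; last first.
  move=> t [_ /= /negP]; rewrite -leqNgt geq_max => /andP[nt _].
  by rewrite nP // linear0 scaler0.
rewrite -fsbig_ord linear_sum /= (bigD1 (Ordinal km)) //= big1 => [|t tk].
  rewrite addr0 linearZ /= scalar_part_contract Xk Yk /GRing.scale /=.
  by rewrite expr2 -!mulrA mulKf // pnatr_eq0 -lt0n fact_gt0.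
rewrite linearZ /= scalar_part_contract -Xk component_component.
have /negbTE -> : val t != k.
  by apply: contraNneq tk => tk; apply/eqP/val_inj.
by rewrite linear0 mulr0 mul0r scaler0.
Qed.

End RankOne.

Section VeePowers.
Context (C : numClosedFieldType) (V : lmodType C).

Lemma tensor_eval_vee_pow (phi : {linear V -> C^o}) (X : sym_tensor V) n :
  tensor_eval phi (sym_val (vee_pow X n)) = (tensor_eval phi (sym_val X) : C) ^+ n.
Proof.
elim: n => [|n IH].
  by rewrite /= tensor_eval_Sym tensor_evalE big_nil expr0.
by rewrite /vee_pow iterS -/(vee_pow X n) /= tensor_eval_Sym tensor_evalM IH exprS.
Qed.

Lemma of_degree_vee k l (X Y : sym_tensor V) :
  of_degree k X -> of_degree l Y -> of_degree (k + l) (vee X Y).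
Proof.
move=> Xk Yl; rewrite /of_degree /= component_Sym -Xk -Yl.
by rewrite component_tmul.
Qed.

Lemma of_degree_vee_pow k (X : sym_tensor V) n :
  of_degree k X -> of_degree (n * k) (vee_pow X n).
Proof.
move=> Xk; elim: n => [|n IH].
  by rewrite mul0n /of_degree /= component_Sym componentE.
by rewrite mulSn /vee_pow iterS; exact: of_degree_vee.
Qed.

Lemma of_degreeZ k a (X : sym_tensor V) : of_degree k X -> of_degree k (a *: X).
Proof. by move=> Xk; rewrite /of_degree !linearZ /= Xk. Qed.

End VeePowers.

Section ConjugateFunctional.
Context (C : numClosedFieldType) (V : lmodType C) (c : antilinear_involution V).
Context (phi : {linear V -> C^o}).

(** The two conjugations make this linear; it is the functional whose evaluation of
    Y^* is conjugate to the evaluation of Y at phi. *)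
Definition conj_functional (v : V) : C^o := (phi (c v) : C)^*.

Lemma conj_functional_linear : linear conj_functional.
Proof.
move=> a x y; rewrite /conj_functional ai_antilinear linearP.
have key (p q : C) : (a^* * p + q)^* = a * p^* + q^*.
  by rewrite rmorphD rmorphM /= conjCK.
exact: key.
Qed.
HB.instance Definition _ :=
  GRing.isLinear.Build C V C^o _ conj_functional conj_functional_linear.

Lemma tensor_eval_tstar X :
  tensor_eval conj_functional (tstar c X) = (tensor_eval phi X : C)^*.
Proof.
rewrite -[LHS]conjCK; congr (_^*).
apply: (@ta_ext C V C^o (fun X => (tensor_eval conj_functional (tstar c X) : C)^*)
  (tensor_eval phi)) => [a Y Z||s].
- have key (p q : C) : (a^* * p + q)^* = a * p^* + q^*.
    by rewrite rmorphD rmorphM /= conjCK.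
  by rewrite tstarD linearP; exact: key.
- exact: tensor_eval_linear.
rewrite tstarE !tensor_evalE (perm_big _ (permEl (perm_rev _))) /= big_map.
by rewrite rmorph_prod; apply: eq_bigr => x _; rewrite /= /conj_functional conjCK ai_involutive.
Qed.

Lemma component_tstar k (X : tensor_algebra V) :
  component k (tstar c X) = tstar c (component k X).
Proof.
apply: (@ta_ext C V (conj_lmod (tensor_algebra V))
  (fun X => component k (tstar c X)) (fun X => tstar c (component k X))).
- by move=> a Y Z; rewrite tstarD linearP.
- by move=> a Y Z; rewrite linearP tstarD.
move=> s; rewrite tstarE !componentE size_rev size_map.
case: ifP => _; first by rewrite tstarE.
by have := tstarD c (-1) 0 0; rewrite scaler0 addr0 rmorphN1 scaleN1r addNr.
Qed.

Lemma of_degree_sym_star k X : of_degree k X -> of_degree k (sym_star c X).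
Proof. by move=> Xk; rewrite /of_degree /= component_tstar Xk. Qed.

Definition rank_one_form (v w : V) : C := conj_functional v * (phi w : C).

Lemma rank_one_form_bilinear : bilinear_for *%R *%R rank_one_form.
Proof.
split=> [w|v] a x y; rewrite /rank_one_form linearP /=.
  by rewrite mulrDl -mulrA.
by rewrite mulrDr mulrCA.
Qed.
HB.instance Definition _ :=
  bilinear_isBilinear.Build C V V C *%R *%R rank_one_form rank_one_form_bilinear.

Lemma rank_one_form_hermitian v w :
  rank_one_form v w = (rank_one_form (c w) (c v))^*.
Proof.
by rewrite /rank_one_form /conj_functional !ai_involutive rmorphM /= conjCK mulrC.
Qed.

(** The scalar part of T^* * T, for T the n-th term of the exponential of X. For
    X of degree 2 the factorials form a central binomial coefficient, whence
    the lack of decay. *)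
Lemma scalar_part_star_power k X n : of_degree k X ->
  sym_scalar_part (star_product rank_one_form
    (sym_star c ((n`!%:R)^-1 *: vee_pow X n)) ((n`!%:R)^-1 *: vee_pow X n)) =
  (n * k)`!%:R / (n`!%:R) ^+ 2 * `|tensor_eval phi (sym_val X) : C| ^+ (2 * n).
Proof.
move=> Xk; have Ek := of_degreeZ (n`!%:R)^-1 (of_degree_vee_pow n Xk).
rewrite (@scalar_part_star _ _ conj_functional phi _ _ (n * k)) //; last first.
  exact: of_degree_sym_star.
rewrite /= tensor_eval_tstar linearZ /= tensor_eval_vee_pow.
set z := tensor_eval phi _; rewrite /GRing.scale /= rmorphM rmorphXn fmorphV rmorph_nat.
rewrite exprM normCK exprMn_comm; last exact: mulrC.
have key (a b p q : C) : a * (b^-1 * q) * (b^-1 * p) = a / b ^+ 2 * (p * q).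
  by rewrite -exprVn; ring.
exact: key.
Qed.

End ConjugateFunctional.

(** * Continuous functionals separate points *)

(** The radius of a disc is an element of R[i]; being positive, it is real. *)
Lemma small_scalars (R : realType) (A : set (R[i])^o) : nbhs 0 A ->
  exists2 e : R, 0 < e & forall a : R[i], `|a| <= (e%:C)%C -> A a.
Proof.
move=> /nbhs_ballP[d d0 dA].
have Imd : complex.Im d = 0 by apply: ger0_Im; apply: ltW.
have dE : d = ((complex.Re d)%:C)%C by case: d Imd {d0 dA} => x y /= ->.
have Red : 0 < complex.Re d by rewrite -ltcR -dE.
exists (complex.Re d / 2); first by rewrite divr_gt0.
move=> a ae; apply: dA; rewrite -ball_normE /= sub0r normrN (le_lt_trans ae) //.
by rewrite dE ltcR ltr_pdivrMr // ltr_pMr // ltr1n.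
Qed.

Section Gauge.
Context (R : realType) (V : tvsType R[i]).
Local Open Scope complex_scope.
Import ComplexField.Normc.

Context (W : set V).
Hypothesis W_balanced : forall (a : R[i]) x, `|a| <= 1 -> W x -> W (a *: x).
Hypothesis W_convex : forall (t : R) x y, 0 <= t -> t <= 1 -> W x -> W y ->
  W (t%:C *: x + (1 - t)%:C *: y).
Hypothesis W_nbhs : nbhs 0 W.

Let inflations (x : V) := [set r : R | 0 < r /\ W ((r^-1)%:C *: x)].

Definition gauge (x : V) : R := inf (inflations x).

Let normc_normC (a : R[i]) : `|a| = (normc a)%:C.
Proof. by []. Qed.

(* W is absorbing: t *: x tends to 0 with t. *)
Let inflations_nonempty x : inflations x !=set0.
Proof.
have := @scale_continuous _ V (0, x) W; rewrite scale0r => /(_ W_nbhs).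
move=> [[A B] /= [A0 Bx] AB].
have [e e0 eA] := small_scalars A0.
exists e^-1; split; first by rewrite invr_gt0.
rewrite invrK; apply: (AB (e%:C, x)); split=> /=; last exact: nbhs_singleton.
by apply: eA; rewrite ger0_norm // ler0c ltW.
Qed.

Let has_inf_inflations x : has_inf (inflations x).
Proof. by split; [exact: inflations_nonempty|exists 0 => r [/ltW]]. Qed.

Lemma gauge_ge0 x : 0 <= gauge x.
Proof. by apply: lb_le_inf => [|r [/ltW]//]; exact: inflations_nonempty. Qed.

Let gauge_le x r : inflations x r -> gauge x <= r.
Proof. by move=> xr; apply: ge_inf => //; exists 0 => s [/ltW]. Qed.

Lemma gauge_lt x r : gauge x < r -> W ((r^-1)%:C *: x).
Proof.
move=> xr; have r0 : 0 < r by exact: le_lt_trans (gauge_ge0 x) xr.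
have rx : 0 < r - gauge x by rewrite subr_gt0.
have [s [s0 Ws]] := inf_adherent rx (has_inf_inflations x).
rewrite addrC subrK => sr.
have -> : (r^-1)%:C *: x = (s / r)%:C *: ((s^-1)%:C *: x).
  by rewrite scalerA -rmorphM mulrAC divff ?gt_eqF // mul1r.
apply: W_balanced Ws; rewrite ger0_norm; last by rewrite ler0c divr_ge0 // ltW.
by rewrite (lecR _ 1) ler_pdivrMr // mul1r ltW.
Qed.

Lemma gaugeD x y : gauge (x + y) <= gauge x + gauge y.
Proof.
apply/ler_addgt0Pl => e e0.
pose r := gauge x + e / 2; pose s := gauge y + e / 2.
have r0 : 0 < r by rewrite ltr_wpDl ?gauge_ge0 // divr_gt0.
have s0 : 0 < s by rewrite ltr_wpDl ?gauge_ge0 // divr_gt0.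
have rs0 : 0 < r + s by exact: addr_gt0.
have Wx : W ((r^-1)%:C *: x) by apply: gauge_lt; rewrite ltrDl divr_gt0.
have Wy : W ((s^-1)%:C *: y) by apply: gauge_lt; rewrite ltrDl divr_gt0.
have -> : e + (gauge x + gauge y) = r + s by rewrite /r /s; field.
apply: gauge_le; split=> //.
(* (x + y) / (r + s) is the mean of x / r and y / s with weights r and s. *)
have -> : ((r + s)^-1)%:C *: (x + y) =
    (r / (r + s))%:C *: ((r^-1)%:C *: x) +
    (1 - r / (r + s))%:C *: ((s^-1)%:C *: y).
  rewrite !scalerA -!rmorphM scalerDr; congr (_%:C *: _ + _%:C *: _).
    by field; rewrite ?gt_eqF.
  by field; rewrite ?gt_eqF.
apply: W_convex => //; first by rewrite divr_ge0 // ltW.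
by rewrite ler_pdivrMr // mul1r lerDl ltW.
Qed.

Let gaugeZ_le a x : a != 0 -> gauge (a *: x) <= normc a * gauge x.
Proof.
move=> a0; have na0 : 0 < normc a.
  by rewrite -ltcR -normc_normC normr_gt0.
rewrite -ler_pdivrMl //; apply: lb_le_inf => [|r [r0 Wr]]; first exact: inflations_nonempty.
rewrite ler_pdivrMl //; apply: gauge_le; split; first exact: mulr_gt0.
have -> : (((normc a) * r)^-1)%:C *: (a *: x) = (a / `|a|) *: ((r^-1)%:C *: x).
  rewrite !scalerA normc_normC; congr (_ *: _).
  by rewrite invfM rmorphM fmorphV mulrC mulrA.
by apply: W_balanced Wr; rewrite normrM normfV normr_id divff // normr_eq0.
Qed.

Lemma gaugeZ a x : gauge (a *: x) = normc a * gauge x.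
Proof.
have [->|a0] := eqVneq a 0.
  rewrite scale0r normc0 mul0r; apply/eqP; rewrite eq_le gauge_ge0 andbT.
  apply/ler_addgt0Pl => e e0; rewrite addr0; apply: gauge_le; split=> //.
  by rewrite scaler0; exact: nbhs_singleton.
apply/eqP; rewrite eq_le gaugeZ_le //=.
have na0 : 0 < normc a by rewrite -ltcR -normc_normC normr_gt0.
rewrite -ler_pdivlMl // -normcV.
have {1}-> : x = a^-1 *: (a *: x) by rewrite scalerA mulVf // scale1r.
by apply: gaugeZ_le; rewrite invr_eq0.
Qed.

Lemma gauge_seminorm : seminorm gauge.
Proof. by split; [exact: gaugeD|exact: gaugeZ]. Qed.

Lemma gauge_continuous : continuous gauge.
Proof.
move=> x; apply/(@cvgrPdist_le _ R^o) => e e0.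
have W0 : \forall y \near x, W ((e^-1)%:C *: (x - y)).
  have xx : (fun y => (e^-1)%:C *: (x - y)) @ x --> (0 : V).
    have -> : (0 : V) = (e^-1)%:C *: (x - x) by rewrite subrr scaler0.
    apply: (@continuous2_cvg _ (R[i]^o : topologicalType) V V (nbhs x) _
      (fun=> (e^-1)%:C) (fun y => x - y) (fun a z => a *: z)).
    - exact: (@scale_continuous _ V ((e^-1)%:C, x - x)).
    - exact: cvg_cst.
    apply: (@continuous2_cvg _ V V V (nbhs x) _ (fun=> x) id (fun z y => z - y)).
    - exact: (@sub_continuous V (x, x)).
    - exact: cvg_cst.
    - exact: cvg_id.
  exact: xx W_nbhs.
apply: filterS W0 => y Wy.
have xy : gauge (x - y) <= e by apply: gauge_le.
have yx : gauge (y - x) <= e.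
  by rewrite -opprB -scaleN1r gaugeZ normcN normc1 mul1r.
have := gaugeD (x - y) y; have := gaugeD (y - x) x; rewrite !subrK => Hy Hx.
by rewrite ler_norml; apply/andP; split; lra.
Qed.

End Gauge.

Section Separation.
Context (R : realType) (V : tvsType R[i]).
Hypothesis V_hausdorff : hausdorff_space V.
Hypothesis V_hilbert : hilbert_seminorms_cofinal V.
Local Open Scope complex_scope.

Lemma separating_seminorm (v : V) : v != 0 ->
  exists p : V -> R, [/\ seminorm p, continuous p & 0 < p v].
Proof.
move=> v0.
have Nv : nbhs (0 : V) (~` [set v]).
  apply: open_nbhs_nbhs; split; last by move=> /esym/eqP; rewrite (negbTE v0).
  by apply/closed_openC/accessible_closed_set1/hausdorff_accessible.
have [B B_convex [B_open B_basis]] := @locally_convex _ V.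
have [U [BU U0] Uv] := B_basis 0 _ Nv.
have Uconv := B_convex _ (mem_set BU).
(* The balanced core of U, convex because U is. *)
pose W := [set x : V | forall a : R[i], `|a| <= 1 -> U (a *: x)].
have WU x : W x -> U x by move=> /(_ 1); rewrite normr1 scale1r; apply.
have W_balanced (a : R[i]) x : `|a| <= 1 -> W x -> W (a *: x).
  by move=> a1 Wx b b1; rewrite scalerA; apply: Wx; rewrite normrM mulr_ile1.
have W_convex (t : R) x y : 0 <= t -> t <= 1 -> W x -> W y ->
    W (t%:C *: x + (1 - t)%:C *: y).
  move=> t0 t1 Wx Wy a a1.
  have tC0 : 0 <= t%:C :> R[i] by rewrite ler0c.
  have tC1 : t%:C <= 1 :> R[i] by rewrite (lecR _ 1).
  pose l : {i01 R[i]} := Itv01 tC0 tC1.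
  have := Uconv (a *: x) (a *: y) l (mem_set (Wx _ a1)) (mem_set (Wy _ a1)).
  move=> /set_mem; congr (U _); rewrite scalerDr !scalerA /conv /=.
  by rewrite !scalerA /unstable.onem rmorphB rmorph1 ![a * _]mulrC.
have W_nbhs : nbhs 0 W.
  have := @scale_continuous _ V (0, 0) U; rewrite scaler0 => /(_ _).
  have Un : nbhs (0 : V) U by apply: open_nbhs_nbhs; split=> //; exact: B_open.
  move=> /(_ Un) [[A D] /= [A0 D0] AD].
  have [e e0 eA] := small_scalars A0.
  have eC0 : e%:C != 0 :> R[i] by rewrite gt_eqF // (ltcR 0 e).
  apply: filterS (nbhs0Z eC0 D0) => _ [x Dx <-] a a1.
  rewrite scalerA; apply: (AD (a * e%:C, x)); split=> //=; apply: eA.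
  by rewrite normrM (ger0_norm (_ : 0 <= e%:C)) ?ler_piMl ?ler0c // ltW.
exists (gauge W); split.
- exact: gauge_seminorm.
- exact: gauge_continuous.
rewrite ltNge; apply/negP => v_le0.
have := @gauge_lt _ _ W W_balanced W_nbhs v 1; rewrite invr1 scale1r => Wv.
by apply: (Uv v) => //; apply/WU/Wv; exact: le_lt_trans v_le0 _.
Qed.

(** If 0 < p v and p is dominated by the seminorm of h, then h v v <> 0, so the
    functional h (-, v) does not vanish at v. *)
Lemma separating_functional (v : V) : v != 0 ->
  exists2 phi : {linear V -> R[i]^o}, continuous phi & phi v != 0.
Proof.
move=> /separating_seminorm[p [p_sn p_cont pv]].
have [h [h_ge0 h_cont ph]] := V_hilbert p_sn p_cont.
pose phi (w : V) : R[i]^o := h w v.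
have phi_lin : linear phi.
  by move=> a x y; rewrite /phi linearPl.
pose phiL := GRing.isLinear.Build R[i] V R[i]^o *:%R phi phi_lin.
pose f : {linear V -> R[i]^o} := HB.pack phi phiL.
exists f.
  move=> w; apply: (@continuous2_cvg _ V V (R[i]^o : topologicalType) (nbhs w) _
    id (fun=> v) (fun x y => h x y)).
  - exact: h_cont (w, v).
  - exact: cvg_id.
  - exact: cvg_cst.
rewrite /f /= /phi; apply: contraTneq (ph v) => ->.
by rewrite -ltNge /= sqrtr0.
Qed.

End Separation.

(** * Symmetric tensors of degree two *)

Section DegreeTwo.
Context (C : numClosedFieldType) (V : lmodType C).
Local Notation T := (tensor_algebra V).

Lemma functional_mull (phi : {linear V -> C^o}) (z : C) :
  linear (fun x => (phi x : C) * z : C^o).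
Proof.
move=> a u v; rewrite linearP.
have key (p q : C) : (a * p + q) * z = a * (p * z) + q * z by ring.
exact: key.
Qed.

Lemma functional_mulr (phi : {linear V -> C^o}) (z : C) :
  linear (fun x => z * (phi x : C) : C^o).
Proof.
move=> a u v; rewrite linearP.
have key (p q : C) : z * (a * p + q) = a * (z * p) + z * q by ring.
exact: key.
Qed.

Lemma component2_sum (X : T) : exists r : seq (V * V),
  component 2 X = \sum_(p <- r) tens [:: p.1; p.2].
Proof.
elim/pgen_ind: X => [|a X Y [r Xr] [q Yq]|s].
- by exists [::]; rewrite linear0 big_nil.
- exists ([seq (a *: p.1, p.2) | p <- r] ++ q).
  rewrite component_linear Xr Yq big_cat big_map /= scaler_sumr; congr (_ + _).
  apply: eq_bigr => p _; have := @tens_multilinear _ V [::] [:: p.2] a p.1 0.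
  have := @tens_multilinear _ V [::] [:: p.2] (-1) 0 0.
  by rewrite /= scaler0 !addr0 scaleN1r addNr => -> ; rewrite addr0.
rewrite -/(tens s) componentE.
case: s => [|x [|y [|z s]]] /=; try by exists [::]; rewrite big_nil.
by exists [:: (x, y)]; rewrite big_seq1.
Qed.

Section PairEval.
Context (phi psi : {linear V -> C^o}).

Let pair_word (s : seq V) : C^o :=
  if s is [:: x; y] then (phi x : C) * psi y else 0.

Definition pair_eval : T -> C^o := ta_lift pair_word.

Let pair_word_multilinear : multilinear pair_word.
Proof.
case=> [|x [|y s]] [|z [|? ?]] a u v /=;
  try by [rewrite scaler0 addr0|case: s => [|? ?] /=; rewrite scaler0 addr0].
- exact: functional_mull.
- exact: functional_mulr.
Qed.

Lemma pair_eval_linear : linear pair_eval.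
Proof. exact: ta_lift_linear. Qed.
HB.instance Definition _ := GRing.isLinear.Build C T C^o _ pair_eval pair_eval_linear.

Lemma pair_eval2 x y : pair_eval (tens [:: x; y]) = (phi x : C) * psi y.
Proof. exact: ta_liftE. Qed.

Lemma pair_eval0 s : size s != 2 -> pair_eval (tens s) = 0.
Proof.
by rewrite /pair_eval ta_liftE //; case: s => [|x [|y [|z s]]].
Qed.
End PairEval.

(** On two letters, composing with the transposition permutes the summands of the
    symmetrisation and exchanges phi and psi. *)
Lemma pair_eval_Sym phi psi (X : T) :
  pair_eval phi psi (Sym X) = pair_eval psi phi (Sym X).
Proof.
apply: (@ta_ext C V C^o (fun X => pair_eval phi psi (Sym X))
  (fun X => pair_eval psi phi (Sym X))) => [a Y Z|a Y Z|s].
- by rewrite !linearP.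
- by rewrite !linearP.
rewrite SymE /sym_word !linearZ !linear_sum /=; congr (_ *: _).
have [s2|s2] := eqVneq (size s) 2; last first.
  by rewrite !big1 // => sigma _; rewrite pair_eval0 // sym_words_size.
rewrite s2.
have enum2 : enum 'I_2 = [:: ord0; ord_max].
  by apply: (inj_map val_inj); rewrite val_enum_ord.
rewrite enum2 (reindex_inj (mulgI (tperm ord0 ord_max))) /=.
apply: eq_bigr => sigma _.
by rewrite !pair_eval2 !permM tpermL tpermR mulrC.
Qed.

(** Gaussian elimination on the number of terms. Applying phi0 with
    phi0 x <> 0 to the left factors expresses y through the other right factors,
    and substituting this for y absorbs the term B x y into the others. The
    substitution is valid for every bilinear map; it is used for B and for
    the products phi u * psi v, so that the hypothesis carries over to the
    shorter sum. The predicate P singles out a family of functionals that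
    separates points. *)
Lemma bilinear_sum_eq0 (P : {linear V -> C^o} -> Prop)
    (P_sep : forall v, v != 0 -> exists2 phi : {linear V -> C^o}, P phi & phi v != 0)
    (W : lmodType C) (B : V -> V -> W)
    (Bl : forall y, linear (B ^~ y)) (Br : forall x, linear (B x))
    (r : seq (V * V)) :
  (forall phi psi : {linear V -> C^o}, P phi -> P psi ->
     \sum_(p <- r) (phi p.1 : C) * psi p.2 = 0) ->
  \sum_(p <- r) B p.1 p.2 = 0.
Proof.
have Bl0 (W' : lmodType C) (B' : V -> V -> W') y :
    (forall y, linear (B' ^~ y)) -> B' 0 y = 0.
  by move=> lB; have := lB y (-1) 0 0; rewrite scaler0 addr0 scaleN1r addNr.
move En : (size r) => n; elim: n r En => [|n IH] r.
  by move=> /size0nil -> _; rewrite big_nil.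
case: r => [//|[x y] r] /= [rn] r0.
have [x0|x0] := eqVneq x 0.
  rewrite big_cons /= x0 Bl0 // add0r; apply: IH => // phi psi Pphi Ppsi.
  by have := r0 phi psi Pphi Ppsi; rewrite big_cons /= x0 linear0 mul0r add0r.
have [phi0 Pphi0 phi0x] := P_sep _ x0.
pose k (p : V * V) : C := (phi0 p.1 : C) / phi0 x.
have yE : y = - \sum_(p <- r) k p *: p.2.
  apply/eqP; rewrite -addr_eq0; apply: contraT => /P_sep[psi Ppsi].
  have := r0 phi0 psi Pphi0 Ppsi; rewrite big_cons /= => r0'.
  rewrite linearD linear_sum /= => /negP[]; apply/eqP.
  apply: (mulfI phi0x); rewrite mulr0 mulrDr -[RHS]r0'; congr (_ + _).
  rewrite mulr_sumr; apply: eq_bigr => p _; rewrite linearZ /=.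
  have key (a b q : C) : a != 0 -> a * (b / a * q) = b * q by move=> ?; field.
  exact: key.
(* The remaining terms after the substitution of yE for y. *)
pose r' := [seq (p.1 - k p *: x, p.2) | p <- r].
have step (W' : lmodType C) (B' : V -> V -> W') :
    (forall y, linear (B' ^~ y)) -> (forall x, linear (B' x)) ->
    \sum_(p <- (x, y) :: r) B' p.1 p.2 = \sum_(p <- r') B' p.1 p.2.
  move=> lB rB; rewrite big_cons /= {1}yE big_map /=.
  have -> : B' x (- \sum_(p <- r) k p *: p.2) = \sum_(p <- r) - (k p *: B' x p.2).
    pose f := HB.pack_for {linear V -> W'} (B' x) (GRing.isLinear.Build _ _ _ _ (B' x) (rB x)).
    rewrite -[B' x]/(f : V -> W') linearN linear_sum -sumrN.
    by apply: eq_bigr => p _; rewrite linearZ.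
  rewrite -big_split; apply: eq_bigr => p _ /=.
  by rewrite -!scaleNr -lB addrC.
rewrite step //; apply: IH => [|phi psi Pphi Ppsi]; first by rewrite size_map.
rewrite -(step C^o (fun x y => (phi x : C) * psi y)) ?r0 // => u a v w.
- exact: functional_mull.
- exact: functional_mulr.
Qed.

(** Polarisation: the value at phi + psi yields the vanishing of the
    mixed terms, twice the value of phi (x) psi by symmetry of X. *)
Lemma sym2_eval_neq0 (P : {linear V -> C^o} -> Prop)
    (P_add : forall phi psi : {linear V -> C^o}, P phi -> P psi -> P (phi \+ psi))
    (P_sep : forall v, v != 0 -> exists2 phi : {linear V -> C^o}, P phi & phi v != 0)
    (X : sym_tensor V) :
  of_degree 2 X -> X != 0 ->
  exists2 phi : {linear V -> C^o}, P phi & tensor_eval phi (sym_val X) != 0.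
Proof.
move=> X2 X0; apply: contrapT => noP.
have ev0 (phi : {linear V -> C^o}) : P phi -> tensor_eval phi (sym_val X) = 0.
  by move=> Pphi; apply/eqP; apply: contraT => e; case: noP; exists phi.
have [r Xr] := component2_sum (sym_val X); rewrite X2 in Xr.
have pairE phi psi :
    pair_eval phi psi (sym_val X) = \sum_(p <- r) (phi p.1 : C) * psi p.2.
  by rewrite Xr linear_sum; apply: eq_bigr => p _; rewrite /= pair_eval2.
have pairC phi psi : pair_eval phi psi (sym_val X) = pair_eval psi phi (sym_val X).
  by case: (X) => ? /= /is_symmetricP[Y ->]; exact: pair_eval_Sym.
have evE (phi : {linear V -> C^o}) : tensor_eval phi (sym_val X) = pair_eval phi phi (sym_val X).
  rewrite pairE {1}Xr linear_sum; apply: eq_bigr => p _.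
  by rewrite /= tensor_evalE big_cons big_seq1.
case/negP: X0; apply/eqP/val_inj; rewrite /= Xr.
apply: (bilinear_sum_eq0 P_sep (B := fun x y => tens [:: x; y])).
- by move=> y a x x'; exact: (@tens_multilinear _ V [::] [:: y]).
- by move=> x a y y'; exact: (@tens_multilinear _ V [:: x] [::]).
move=> phi psi Pphi Ppsi; rewrite -pairE.
have := ev0 _ (P_add _ _ Pphi Ppsi); rewrite evE pairE.
under eq_bigr do rewrite /= mulrDl !mulrDr.
rewrite !big_split /= -!pairE -!evE !ev0 // add0r addr0 (pairC psi phi) -mulr2n.
by move/eqP; rewrite mulrn_eq0 /= => /eqP.
Qed.

Lemma tensor_evalZ (a : C) (phi : {linear V -> C^o}) k (X : T) :
  tensor_eval (a \*: phi) (component k X) = a ^+ k * (tensor_eval phi (component k X) : C).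
Proof.
apply: (@ta_ext C V C^o (fun X => tensor_eval (a \*: phi) (component k X))
  (fun X => a ^+ k * (tensor_eval phi (component k X) : C))) => [b Y Z|b Y Z|s].
- by rewrite !linearP.
- have key (z p q : C) : z * (b * p + q) = b * (z * p) + z * q by ring.
  by rewrite !linearP; exact: key.
rewrite componentE; case: eqP => [<-|_]; last by rewrite !linear0 mulr0.
rewrite !tensor_evalE; elim: s => [|x s IH]; first by rewrite !big_nil mulr1.
by rewrite !big_cons IH /= exprS /GRing.scale /= mulrACA.
Qed.

End DegreeTwo.

(** * Continuity *)

Section Continuity.
Context (R : realType).
Local Notation C := R[i].

Lemma conj_continuous : continuous (Num.conj : C^o -> C^o).
Proof.
move=> x U /nbhs_ballP[e e0 eU]; apply/nbhs_ballP; exists e => // y.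
rewrite -ball_normE /= => xy; apply: eU.
by rewrite -ball_normE /= -rmorphB norm_conjC.
Qed.

Context (V : tvsType C).

Lemma functionalD_continuous (phi psi : {linear V -> C^o}) :
  continuous phi -> continuous psi -> continuous (phi \+ psi).
Proof. by move=> cphi cpsi x; apply: cvgD; [exact: cphi|exact: cpsi]. Qed.

Lemma functionalZ_continuous a (phi : {linear V -> C^o}) :
  continuous phi -> continuous (a \*: phi).
Proof.
move=> cphi x; apply: (@continuous2_cvg _ (C^o : topologicalType) C^o C^o (nbhs x) _
  (fun=> a) phi (fun b z => b *: z)).
- exact: (@scale_continuous _ C^o (a, phi x)).
- exact: cvg_cst.
- exact: cphi.
Qed.

Lemma rank_one_form_continuous (c : antilinear_involution V)
    (phi : {linear V -> C^o}) :
  continuous c -> continuous phi -> continuous_form (rank_one_form c phi).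
Proof.
move=> c_cont phi_cont [v w].
apply: (@continuous2_cvg _ (C^o : topologicalType) C^o C^o (nbhs (v, w)) _
  (fun z => conj_functional c phi z.1) (fun z => phi z.2) (fun a b => a *: b)).
- exact: (@scale_continuous _ C^o (conj_functional c phi v, phi w)).
- apply: (@continuous_comp _ _ C^o (fun z : V * V => phi (c z.1)) Num.conj);
    last exact: conj_continuous.
  apply: (@continuous_comp _ _ C^o (fun z : V * V => c z.1) phi);
    last exact: phi_cont.
  by apply: (@continuous_comp _ _ _ fst c); [exact: cvg_fst|exact: c_cont].
- by apply: (@continuous_comp _ _ C^o snd phi); [exact: cvg_snd|exact: phi_cont].
Qed.

End Continuity.

(** The terms are differences of consecutive partial sums, so their images in the
    completion tend to 0; the topology is the one induced from there. *)
Lemma series_terms_cvg0 (K : numFieldType) (E : lmodType K) (tau : topology_on E)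
    (u : nat -> E) :
  @cvg_in_completion K (topologized tau) (series u) ->
  (u : nat -> topologized tau) @ \oo --> (0 : topologized tau).
Proof.
move=> [W [i [[_ _ _ nbhsE] [w Sw]]]].
have iu : (fun n => i (u n)) @ \oo --> (0 : W).
  have -> : (fun n => i (u n)) = (fun n => i (series u n.+1) - i (series u n)).
    by apply/funext => n; rewrite -linearB /series /= big_nat_recr //= addrAC subrr add0r.
  rewrite -(subrr w).
  apply: (@continuous2_cvg _ W W W \oo _ _ _ (fun x y => x - y)).
  - exact: (@sub_continuous W (w, w)).
  - by move=> U /Sw[N _ NU]; exists N => // n Nn; exact: (NU n.+1 (leqW Nn)).
  - exact: Sw.
move=> U /nbhsE[O O0 OU].
rewrite linear0 in O0.
by have [N _ NO] := iu _ O0; exists N => // n Nn; exact: OU (NO n Nn).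
Qed.

Lemma leq_mul_fact_double n : (n`! * n`! <= (n * 2)`!)%N.
Proof.
have le : (n <= n * 2)%N by rewrite leq_pmulr.
rewrite -(bin_fact le) muln2 -addnn addnK leq_pmull //.
by rewrite bin_gt0 leq_addr.
Qed.

(** * The obstruction *)

Theorem proposition3p38 (R : realType) (V : tvsType R[i])
    (V_hausdorff : hausdorff_space V)
    (V_hilbert : hilbert_seminorms_cofinal V)
    (c : antilinear_involution V) (c_continuous : continuous c) :
  ~ exists tau : topology_on (sym_tensor V),
    [/\ locally_convex_topology tau,
        exists X : sym_tensor V,
          [/\ of_degree 2 X, X != 0 &
              @cvg_in_completion R[i] (topologized tau) (exp_partial_sum X)] &
        [/\ forall L : {biscalar V}, continuous_form L -> hermitian_wrt c L ->
              continuous (fun z : topologized tau * topologized tau =>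
                star_product L z.1 z.2 : topologized tau),
            continuous (sym_star c : topologized tau -> topologized tau) &
            continuous (@sym_scalar_part R[i] V : topologized tau -> R[i]^o)]].
Proof.
move=> [tau [_ [X [X2 X0 expX]] [star_cont invol_cont scalar_cont]]].
have [phi1 phi1_cont phi1X] : exists2 phi : {linear V -> R[i]^o},
    continuous phi & tensor_eval phi (sym_val X) != 0.
  exact: (@sym2_eval_neq0 _ V (fun phi : {linear V -> R[i]^o} => continuous phi)
    (@functionalD_continuous R V) (separating_functional V_hausdorff V_hilbert) X X2 X0).
(* In degree 2, rescaling phi1 by a multiplies the value at X by a ^+ 2. *)
pose a := (sqrtC (tensor_eval phi1 (sym_val X) : R[i]))^-1.
pose phi : {linear V -> R[i]^o} := a \*: phi1.
have phi_cont : continuous phi by exact: functionalZ_continuous.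
have phiX : tensor_eval phi (sym_val X) = 1.
  by rewrite -X2 tensor_evalZ X2 exprVn sqrtCK mulVf.
pose L : {biscalar V} := rank_one_form c phi.
have L_cont : continuous_form L by exact: rank_one_form_continuous.
have L_herm : hermitian_wrt c L by exact: rank_one_form_hermitian.
pose u n : topologized tau := (n`!%:R)^-1 *: vee_pow X n.
have u0 : u @ \oo --> (0 : topologized tau) by exact: series_terms_cvg0 expX.
have su0 : (fun n => sym_star c (u n) : topologized tau) @ \oo -->
    (sym_star c 0 : topologized tau).
  exact: cvg_comp u0 (invol_cont 0).
have star0 : (fun n => star_product L (sym_star c (u n)) (u n) : topologized tau)
    @ \oo --> (star_product L (sym_star c 0) 0 : topologized tau).
  apply: (@continuous2_cvg _ (topologized tau) (topologized tau) (topologized tau)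
    \oo _ _ _ (fun x y => star_product L x y : topologized tau)) su0 u0.
  exact: star_cont L L_cont L_herm (sym_star c 0, 0).
pose value n : R[i]^o := sym_scalar_part (star_product L (sym_star c (u n)) (u n)).
pose l : R[i]^o := sym_scalar_part (star_product L (sym_star c 0) 0).
have val_l : value @ \oo --> l by exact: cvg_comp star0 (scalar_cont _).
have zero0 : of_degree 0 (0 : sym_tensor V) by exact: linear0.
(* The limit is computed with 0 regarded as homogeneous of degree 0. *)
have l0 : l = 0.
  apply: (etrans (@scalar_part_star _ _ (conj_functional c phi) phi L
    (fun _ _ => erefl) 0 _ _ (of_degree_sym_star c zero0) zero0)).
  have -> : tensor_eval phi (sym_val 0) = 0 := linear0 _.
  by rewrite mulr0.
have valueE n : value n = (n * 2)`!%:R / (n`!%:R) ^+ 2.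
  apply: (etrans (scalar_part_star_power c phi n X2)).
  by rewrite phiX normr1 expr1n mulr1.
have [n _ /(_ n (leqnn n))] : \forall n \near \oo, `|value n| < 1.
  by move: val_l; rewrite l0 => /cvgr0Pnorm_lt/(_ 1 ltr01).
rewrite /= valueE.
rewrite ger0_norm ?divr_ge0 ?exprn_ge0 ?ler0n //.
rewrite ltr_pdivrMr ?exprn_gt0 ?ltr0n ?fact_gt0 // mul1r -natrX ltr_nat.
by rewrite ltnNge -mulnn leq_mul_fact_double.
Qed.
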